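(* Let $n$ be a nonnegative integer. For every integer $x>n+1$, \[ sf^{(n)}(x) \bmod P_{n+2}(x)=0 \iff \sum_{i=1}^{n+1}\left\lfloor \frac{x}{p_{\pi(x)+1}-i}\right\rfloor\left\lfloor \frac{p_{\pi(x)+1}-i}{x}\right\rfloor=0 . \]
   Context: For integers $r\ge 0$ and $m\ge 1$, $P_r(m)=\binom{m+r-1}{r}$ is the $r$-simplex (figurate) number; in particular $P_{n+2}(x)=\binom{x+n+1}{n+2}$. The generalized superfactorial is defined for positive integers $x$ by $sf^{(0)}(x)=x!$ and $sf^{(n)}(x)=\prod_{k=1}^{x}sf^{(n-1)}(k)$ for $n\ge1$. $\pi$ is the prime-counting function and $p_k$ is the $k$th prime, so $p_{\pi(x)+1}$ is the smallest prime greater than $x$. $a \bmod b$ denotes the least nonnegative remainder of $a$ upon division by $b$. *)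

(* Defs.v *)
(* MathComp. *)
From mathcomp Require Import all_boot.

Set Implicit Arguments.
Unset Strict Implicit.
Unset Printing Implicit Defensive.

(* For m = 0 the truncated subtraction gives a junk value; only m >= 1 is
   meaningful. *)
Definition simplex_number (r m : nat) : nat := 'C(m + r - 1, r).

Fixpoint superfactorial (n x : nat) : nat :=
  if n is n'.+1 then \prod_(1 <= k < x.+1) superfactorial n' k else x`!.

Definition prime_count (x : nat) : nat := \sum_(1 <= q < x.+1 | prime q) 1.

Lemma exists_prime_gt (m : nat) : exists p, (m < p) && prime p.
Proof. by have [p ltmp prp] := prime_above m; exists p; rewrite ltmp. Qed.

Definition next_prime (m : nat) : nat := ex_minn (exists_prime_gt m).

(* Primes are numbered from 1, so p_1 = 2; the value 0 at index 0 only seeds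
   the recursion. *)
Fixpoint kth_prime (k : nat) : nat :=
  if k is k'.+1 then next_prime (kth_prime k') else 0.

(* Main.v *)
Require Import Defs.
From mathcomp Require Import all_boot.
From mathcomp Require Import zify.

(** Write [p] for the smallest prime above [x] and [N = x + n + 1 < 2 x].  The
    sum counts the [i] with [p - i = x], so it vanishes iff there is no prime in
    [(x, N]].  Such a prime divides [P_(n+2)(x) = 'C(N, n + 2)] but not
    [sf^(n)(x)], a product of integers at most [x].  Conversely, if a prime power
    [q ^ v] divides the binomial exactly, then [q ^ v <= N] by Legendre's formula.
    For [v = 1] the absence of primes gives [q <= x]; for [v >= 3] the factors [q]
    and [q ^ v.-1 <= x] of [x!] are distinct; for [v = 2] one uses [q] and [2 q]
    in [x!] if [n = 0] (which needs [2 q <= x] and so excludes [q = 2], [x = 3]),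
    and the divisor [x! (x - 1)!] of [sf^(n)(x)] otherwise. *)

Lemma next_prime_gt m : m < next_prime m.
Proof. by rewrite /next_prime; case: ex_minnP => p /andP[]. Qed.

Lemma prime_next_prime m : prime (next_prime m).
Proof. by rewrite /next_prime; case: ex_minnP => p /andP[]. Qed.

Lemma next_prime_min m p : m < p -> prime p -> next_prime m <= p.
Proof.
move=> mp pp; rewrite /next_prime; case: ex_minnP => q _; apply.
by rewrite mp.
Qed.

Lemma next_primeS_prime m : prime m.+1 -> next_prime m = m.+1.
Proof.
by move=> pm; apply/eqP; rewrite eqn_leq next_prime_min //= next_prime_gt.
Qed.

Lemma next_primeS_nonprime m : ~~ prime m.+1 -> next_prime m.+1 = next_prime m.
Proof.
move=> npm; apply/eqP; rewrite eqn_leq !next_prime_min ?prime_next_prime //.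
  exact: ltnW (next_prime_gt _).
rewrite ltn_neqAle next_prime_gt andbT.
by apply: contraNneq npm => ->; exact: prime_next_prime.
Qed.

Lemma kth_primeS k : kth_prime k.+1 = next_prime (kth_prime k).
Proof. by []. Qed.

(** Induction on [x]: at a prime [x.+1] the index grows by one and [next_prime x] is [x.+1] itself;
    otherwise neither side changes. *)
Lemma kth_prime_prime_count x : kth_prime (prime_count x + 1) = next_prime x.
Proof.
rewrite addn1; elim: x => [|x IHx]; first by rewrite /prime_count big_geq.
have -> : prime_count x.+1 = prime_count x + prime x.+1.
  rewrite /prime_count big_mkcond big_nat_recr //= -big_mkcond /=.
  by case: (prime _).
case: (boolP (prime x.+1)) => [px | npx].
  by rewrite addn1 kth_primeS IHx (next_primeS_prime x).
by rewrite (addn0 (prime_count x)) IHx next_primeS_nonprime.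
Qed.

Lemma divn_mul_divn_eq0 a b : 0 < a -> 0 < b ->
  ((a %/ b) * (b %/ a) == 0) = (a != b).
Proof.
move=> a_gt0 b_gt0; rewrite muln_eq0 !eqn0Ngt !divn_gt0 //.
by rewrite -negb_and eqn_leq andbC.
Qed.

Lemma sum_floor_eq0 n x p : n + 1 < x -> x < p ->
  (\sum_(1 <= i < n.+2) (x %/ (p - i)) * ((p - i) %/ x) == 0) = (x + n.+1 < p).
Proof.
move=> nx xp; rewrite sum_nat_seq_eq0; apply/allP/idP => [h | xnp i].
  rewrite ltnNge; apply/negP => pxn.
  have /h /= : p - x \in index_iota 1 n.+2 by rewrite mem_index_iota; lia.
  by rewrite divn_mul_divn_eq0; lia.
by rewrite mem_index_iota => ? /=; rewrite divn_mul_divn_eq0; lia.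
Qed.

(** By Legendre's formula the exponent of [p] is a sum over [i] of carries, each at most 1 and zero
    as soon as [p ^ i] exceeds [n]. *)
Lemma pfactor_bin_leq p n k : prime p -> 0 < n -> k <= n ->
  p ^ logn p 'C(n, k) <= n.
Proof.
move=> pp n_gt0 kn; have p_gt1 := prime_gt1 pp.
suff h : logn p 'C(n, k) <= trunc_log p n.
  by apply: leq_trans (trunc_logP p_gt1 n_gt0); rewrite leq_exp2l.
(* The Legendre sums of all three factorials get the same range, padded with zero terms, so that
   they compare termwise. *)
have expand m : m <= n -> logn p m`! = \sum_(1 <= i < n.+1) m %/ p ^ i.
  move=> mn; rewrite logn_fact // [RHS](@big_cat_nat _ _ _ m.+1) //=.
  rewrite [X in _ = _ + X]big_nat_cond [X in _ = _ + X]big1 ?addn0 // => i.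
  rewrite andbT => /andP[mi _]; apply: divn_small.
  by apply: leq_ltn_trans (ltn_expl _ p_gt1); apply: ltnW.
have := congr1 (logn p) (bin_fact kn).
rewrite lognM ?bin_gt0 ?muln_gt0 ?fact_gt0 // lognM ?fact_gt0 //.
rewrite !expand ?leq_subr // -big_split /= => eqn.
have t_le : trunc_log p n < n.+1.
  by rewrite ltnS; apply: leq_trans (ltnW (ltn_expl _ p_gt1)) (trunc_logP p_gt1 n_gt0).
have : \sum_(1 <= i < n.+1) n %/ p ^ i <=
  \sum_(1 <= i < n.+1) ((k %/ p ^ i + (n - k) %/ p ^ i) + (i <= trunc_log p n)).
  rewrite big_nat [leqRHS]big_nat; apply: leq_sum => i _.
  have pi_gt0 : 0 < p ^ i by rewrite expn_gt0 prime_gt0.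
  case: (leqP i (trunc_log p n)) => hi.
    by rewrite -{1}(subnKC kn) divnD // leq_add2l leq_b1.
  by rewrite divn_small // (leq_trans (trunc_log_ltn n p_gt1)) // leq_exp2l.
rewrite big_split /= -eqn addnC leq_add2l => /leq_trans; apply.
rewrite (@big_cat_nat _ _ _ (trunc_log p n).+1) //=.
rewrite [X in _ + X <= _]big_nat [X in _ + X <= _]big1 ?addn0; last first.
  by move=> i /andP[ti _]; rewrite leqNgt ti.
rewrite -[leqRHS](_ : \sum_(1 <= i < (trunc_log p n).+1) 1 = _).
  by apply: leq_sum => i _; apply: leq_b1.
by rewrite sum_nat_const_nat subSS subn0 muln1.
Qed.

Lemma prime_dvd_fact p n : prime p -> (p %| n`!) = (p <= n).
Proof.
move=> pp; apply/idP/idP => [|pn]; last by rewrite dvdn_fact // prime_gt0.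
elim: n => [|n IHn]; first by rewrite dvdn1 => /eqP p1; rewrite p1 in pp.
by rewrite factS Euclid_dvdM // => /orP[/dvdn_leq -> // | /IHn /leqW].
Qed.

Lemma superfactorialSS n x :
  superfactorial n.+1 x.+1 = superfactorial n.+1 x * superfactorial n x.+1.
Proof. by rewrite /= big_nat_recr. Qed.

Lemma prime_dvd_superfactorial p n x :
  prime p -> p %| superfactorial n x -> p <= x.
Proof.
move=> pp; elim: n x => [|n IHn] x /=; first by rewrite prime_dvd_fact.
rewrite Euclid_dvd_prod // big_has => /hasP[k].
by rewrite mem_index_iota ltnS => /andP[_ kx] /IHn /leq_trans; apply.
Qed.

Lemma fact_dvd_superfactorial n x : x`! %| superfactorial n x.
Proof.
elim: n x => [|n IHn] x; first exact: dvdnn.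
case: x => [|x]; first exact: dvd1n.
by rewrite superfactorialSS dvdn_mull.
Qed.

Lemma fact_mul_fact_dvd_superfactorial n x :
  x`! * x.+1`! %| superfactorial n.+1 x.+1.
Proof. by rewrite superfactorialSS dvdn_mul ?fact_dvd_superfactorial. Qed.

(** Since [a <= b - 1], it divides [(b - 1)!], and [b! = b * (b - 1)!] divides [x!]. *)
Lemma mul_dvd_fact a b x : 0 < a -> a < b -> b <= x -> a * b %| x`!.
Proof.
case: b => // b a_gt0 ab bx; rewrite -(bin_fact bx) dvdn_mull // dvdn_mulr //.
by rewrite factS mulnC dvdn_mul // dvdn_fact // a_gt0.
Qed.

Lemma prime_power_dvd_superfactorial q v n x : prime q -> n + 1 < x -> 1 < v ->
  q ^ v <= x + n.+1 -> (n, x) != (0, 3) -> q ^ v %| superfactorial n x.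
Proof.
move=> pq nx v_gt1 qvN n3; have q_gt1 := prime_gt1 pq.
have [v2|v_ne2] := eqVneq v 2.
  rewrite v2 -mulnn in qvN *; case: n => [|n] in nx qvN n3 *.
    (* For [q = 2], [4 <= x + 1] and [x <> 3] give [4 <= x]; for [q >= 3],
       [3 * q <= q * q <= x + 1]. *)
    have q2x : 2 * q <= x.
      have x_ne3 : x <> 3 by move=> x3; rewrite x3 in n3.
      have [->|] := eqVneq q 2; first lia.
      nia.
    apply: dvdn_trans (mul_dvd_fact q (2 * q) x _ _ q2x); last 2 first.
    - exact: ltnW.
    - by rewrite mul2n -addnn -[ltnLHS]addn0 ltn_add2l ltnW.
    by rewrite dvdn_mul // dvdn_mull.
  case: x => // x in nx qvN n3 *.
  apply: dvdn_trans (fact_mul_fact_dvd_superfactorial n x).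
  (* With [n] and [x] both shifted by one, [n + 2 <= x], so [q * q <= 2 * x + 1 < (x + 1) ^ 2]. *)
  have qx : q <= x by nia.
  by rewrite dvdn_mul // dvdn_fact //; lia.
case: v => // v in v_gt1 qvN v_ne2 *.
apply: dvdn_trans (fact_dvd_superfactorial n x); rewrite expnS.
(* The exponent is now [v.+1], and [2 * q ^ v <= q * q ^ v <= x + n + 1 < 2 * x]. *)
have qvx : q ^ v <= x by move: qvN; rewrite expnS; nia.
apply: mul_dvd_fact => //; first exact: ltnW.
by rewrite -{1}(expn1 q) ltn_exp2l //; lia.
Qed.

Lemma bin_dvd_superfactorial n x : n + 1 < x ->
  (forall p, prime p -> x < p -> x + n.+1 < p) ->
  'C(x + n.+1, n.+2) %| superfactorial n x.
Proof.
move=> nx noprime.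
(* In this case both numbers are 6, although [2 ^ 2 <= 4] does not divide [3!]. *)
have [[-> ->]|n3] := eqVneq (n, x) (0, 3); first by [].
have kN : n.+2 <= x + n.+1 by lia.
apply/dvdn_partP => [|q]; first by rewrite bin_gt0.
rewrite mem_primes => /and3P[pq _ qC].
have := pfactor_bin_leq q (x + n.+1) n.+2 pq (leq_trans _ kN) kN.
rewrite p_part => /(_ isT); case: (logn _ _) => [|[|v]] qN; first exact: dvd1n.
- apply: dvdn_trans (fact_dvd_superfactorial n x).
  rewrite dvdn_fact // expn1 prime_gt0 //= leqNgt; apply/negP => /(noprime _ pq).
  by rewrite ltnNge -{1}(expn1 q) qN.
- exact: prime_power_dvd_superfactorial.
Qed.

(** [p] divides [n!] but neither [k!] nor [(n - k)!]. *)
Lemma prime_dvd_bin_range p n k : prime p -> k < p -> n - k < p -> p <= n ->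
  p %| 'C(n, k).
Proof.
move=> pp kp nkp pn.
have [kn|nk] := leqP k n; last by rewrite bin_small.
have : p %| n`! by rewrite prime_dvd_fact.
by rewrite -(bin_fact kn) !Euclid_dvdM // !prime_dvd_fact //
  (leqNgt p k) (leqNgt p (n - k)) kp nkp !orbF.
Qed.

(* x > n + 1 gives x < p_(pi(x)+1) and i <= n + 1 < x, so the subtraction
   below is never truncated and no divisor is zero. *)
Theorem theorem7p5 (n x : nat) (hx : n + 1 < x) :
  superfactorial n x %% simplex_number (n + 2) x = 0 <->
  \sum_(1 <= i < n.+2)
     (x %/ (kth_prime (prime_count x + 1) - i)) *
     ((kth_prime (prime_count x + 1) - i) %/ x) = 0.
Proof.
rewrite kth_prime_prime_count.
have -> : simplex_number (n + 2) x = 'C(x + n.+1, n.+2).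
  by rewrite /simplex_number; congr 'C(_, _); lia.
have xp := next_prime_gt x; have pp := prime_next_prime x.
split=> /eqP.
  move=> Csf; apply/eqP; rewrite sum_floor_eq0 // ltnNge.
  apply/negP => pN; move: (xp); apply/negP; rewrite -leqNgt.
  apply: (prime_dvd_superfactorial _ n) => //; apply: dvdn_trans Csf.
  (* The lower index [n + 2] and its complement [x - 1] are both at most [x], hence below the
     prime. *)
  by apply: prime_dvd_bin_range => //; lia.
rewrite sum_floor_eq0 // => Np; apply/eqP/bin_dvd_superfactorial => // p pr_p x_lt_p.
exact: leq_trans Np (next_prime_min _ _ x_lt_p pr_p).
Qed.
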